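(* Let $A$ be a magic square of order $n$ and let $\{P_i\}$ be the set of bisymmetric permutation matrices of order $n$. Then: \begin{itemize} \item for each $i$, the matrices $A,\ A^T,\ P_iAP_i,\ P_iA^TP_i$ all have the same eigenspectrum; \item for each $i$, the matrices $JP_iAP_i,\ P_iAP_iJ,\ P_iA^TP_iJ,\ JP_iA^TP_i$ all have the same eigenspectrum. \end{itemize}
   Context: Let $e_1,\dots,e_n$ be the standard basis column vectors of $\mathbb{R}^n$, $e\in\mathbb{R}^n$ the all-ones column vector, and $J$ the $n\times n$ reverse matrix, with $J_{i,j}=1$ if $i+j=n+1$ and $J_{i,j}=0$ otherwise. A magic square of order $n$ with magic number $\mu$ is a real $n\times n$ matrix $A$ with $e_i^TAe=\mu$ for all $i$, $e^TAe_j=\mu$ for all $j$, $\operatorname{tr}(A)=\mu$ and $\operatorname{tr}(JA)=\mu$. A square matrix $B$ is persymmetric if $JB=(JB)^T$, and bisymmetric if it is both symmetric ($B=B^T$) and persymmetric. The eigenspectrum of a matrix is its collection of (complex) eigenvalues, counted with algebraic multiplicity. *)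

(* Defs.v *)
From HB Require Import structures.
From mathcomp Require Import all_boot all_order all_algebra.
From mathcomp Require Import finmap multiset.
From mathcomp Require Import reals complex.

Set Implicit Arguments.
Unset Strict Implicit.
Unset Printing Implicit Defensive.

Import Order.TTheory GRing.Theory Num.Theory.
Local Open Scope ring_scope.
Local Open Scope complex_scope.
Local Open Scope mset_scope.

Definition std_basis (R : realType) (n : nat) (i : 'I_n) : 'cV[R]_n :=
  delta_mx i 0.

Definition all_ones (R : realType) (n : nat) : 'cV[R]_n := const_mx 1.

(* With indices starting at 0, "i + j = n + 1" becomes "i + j + 1 = n". *)
Definition reverse_mx (R : realType) (n : nat) : 'M[R]_n :=
  \matrix_(i, j) ((i + j).+1 == n)%:R.

(* The products e_i^T A e and e^T A e_j are 1 x 1 matrices, whence [%:M]. *)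
Definition magic_square (R : realType) (n : nat) (mu : R) (A : 'M[R]_n) : Prop :=
  [/\ forall i : 'I_n, (std_basis R i)^T *m A *m all_ones R n = mu%:M,
      forall j : 'I_n, (all_ones R n)^T *m A *m std_basis R j = mu%:M,
      \tr A = mu
    & \tr (reverse_mx R n *m A) = mu].

Definition symmetric_mx (R : realType) (n : nat) (B : 'M[R]_n) : Prop :=
  B = B^T.

Definition persymmetric_mx (R : realType) (n : nat) (B : 'M[R]_n) : Prop :=
  reverse_mx R n *m B = (reverse_mx R n *m B)^T.

Definition bisymmetric_mx (R : realType) (n : nat) (B : 'M[R]_n) : Prop :=
  symmetric_mx B /\ persymmetric_mx B.

Definition complex_mx (R : realType) (n : nat) (B : 'M[R]_n) : 'M[R[i]]_n :=
  map_mx (real_complex R) B.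

(* The multiset of the roots, listed with multiplicity, of the complex
   characteristic polynomial; see [eigenspectrum_mup] and
   [mem_eigenspectrum]. *)
Definition eigenspectrum (R : realType) (n : nat) (B : 'M[R]_n) : {mset R[i]} :=
  seq_mset (sval (closed_field_poly_normal (char_poly (complex_mx B)))).

Lemma eigenspectrum_mup (R : realType) (n : nat) (B : 'M[R]_n) (z : R[i]) :
  eigenspectrum B z = mup z (char_poly (complex_mx B)).
Proof.
rewrite /eigenspectrum mset_seqE; case: closed_field_poly_normal => r /= Dp.
rewrite Dp (monicP (char_poly_monic _)) scale1r {Dp}.
elim: r => [|x r IHr]; first by rewrite big_nil mupNroot // root1.
rewrite big_cons mupM ?polyXsubC_eq0 //; last first.
  by rewrite monic_neq0 // monic_prod_XsubC.
by rewrite -IHr /= -['X - _]expr1 mup_XsubCX eq_sym; case: eqP.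
Qed.

Lemma mem_eigenspectrum (R : realType) (n : nat) (B : 'M[R]_n) (z : R[i]) :
  (z \in eigenspectrum B) = eigenvalue (complex_mx B) z.
Proof.
rewrite eigenvalue_root_char -mset_neq0 eigenspectrum_mup.
by rewrite -lt0n -XsubC_dvd ?dvdp_XsubCl // monic_neq0 ?char_poly_monic.
Qed.

(* Main.v *)
Require Import Defs.
From mathcomp Require Import all_boot all_order all_algebra.
From mathcomp Require Import finmap multiset.
From mathcomp Require Import reals complex.
From mathcomp Require Import fingroup perm zify.

(** The eigenspectrum is a function of the characteristic polynomial, so it is
    invariant under transposition and under similarity ([eigenspectrum_trmx],
    [eigenspectrum_conj]).  A permutation matrix is orthogonal, hence an
    involution when it is symmetric; this applies to [P] and to the reverse
    matrix [J] ([reverse_mxE], [reverse_mxK]).  So [P A P] is a conjugate of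
    [A], which settles the first family.  In the second family,
    [P A P J = J (J P A P) J] is a conjugate of [J P A P], while
    [P A^T P J = (J P A P)^T] and [J P A^T P = (P A P J)^T] are transposes. *)

Import GRing.Theory.
Local Open Scope ring_scope.

Lemma char_poly_trmx {R : comNzRingType} {n : nat} (A : 'M[R]_n) :
  char_poly A^T = char_poly A.
Proof.
rewrite /char_poly -[RHS]det_tr /char_poly_mx.
by rewrite linearB /= tr_scalar_mx map_trmx.
Qed.

(** Conjugation commutes with forming [X%:M - A] over the polynomial ring, and
    the determinant there is invariant under conjugation. *)
Lemma char_poly_conj {R : comNzRingType} {n : nat} {P Q : 'M[R]_n}
    (A : 'M[R]_n) :
  P *m Q = 1%:M -> char_poly (P *m A *m Q) = char_poly A.
Proof.
move=> PQ1.
have CPQ1 : map_mx polyC P *m map_mx polyC Q = 1%:M :> 'M[{poly R}]_n.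
  by rewrite -map_mxM PQ1 map_mx1.
have -> : char_poly (P *m A *m Q)
            = \det (map_mx polyC P *m char_poly_mx A *m map_mx polyC Q).
  rewrite /char_poly /char_poly_mx !map_mxM mulmxBr mulmxBl.
  by rewrite mul_mx_scalar -scalemxAl CPQ1 scalemx1.
by rewrite !det_mulmx mulrAC -det_mulmx CPQ1 det1 mul1r.
Qed.

(** Embedding the entries in the complex numbers maps the characteristic
    polynomial along, so a comparison over [R] suffices. *)
Lemma eq_eigenspectrum {R : realType} {n : nat} (A B : 'M[R]_n) :
  char_poly A = char_poly B -> eigenspectrum A = eigenspectrum B.
Proof.
by move=> eqAB; rewrite /eigenspectrum /complex_mx -!map_char_poly eqAB.
Qed.

Lemma eigenspectrum_trmx {R : realType} {n : nat} (A : 'M[R]_n) :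
  eigenspectrum A^T = eigenspectrum A.
Proof. exact/eq_eigenspectrum/char_poly_trmx. Qed.

Lemma eigenspectrum_conj {R : realType} {n : nat} {P Q : 'M[R]_n}
    (A : 'M[R]_n) :
  P *m Q = 1%:M -> eigenspectrum (P *m A *m Q) = eigenspectrum A.
Proof. by move=> PQ1; apply/eq_eigenspectrum/char_poly_conj. Qed.

Lemma is_perm_mx_mul_tr {R : pzRingType} {n : nat} (P : 'M[R]_n) :
  is_perm_mx P -> P *m P^T = 1%:M.
Proof.
by case/is_perm_mxP=> s ->; rewrite tr_perm_mx -perm_mxM mulgV perm_mx1.
Qed.

Lemma tr_reverse_mx (R : realType) (n : nat) :
  (reverse_mx R n)^T = reverse_mx R n.
Proof. by apply/matrixP=> i j; rewrite !mxE addnC. Qed.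

Lemma reverse_mxE (R : realType) (n : nat) :
  reverse_mx R n = perm_mx (perm (@rev_ord_inj n)).
Proof.
apply/matrixP=> i j; rewrite !mxE permE -val_eqE /=; congr (_%:R).
by have := ltn_ord i; lia.
Qed.

Lemma reverse_mxK (R : realType) (n : nat) :
  reverse_mx R n *m reverse_mx R n = 1%:M.
Proof.
rewrite -{2}tr_reverse_mx is_perm_mx_mul_tr // reverse_mxE.
exact: perm_mx_is_perm.
Qed.

Theorem theorem14 (R : realType) (n : nat) (mu : R) (A : 'M[R]_n) :
  magic_square mu A ->
  (forall P : 'M[R]_n, is_perm_mx P -> bisymmetric_mx P ->
    [/\ eigenspectrum A^T = eigenspectrum A,
        eigenspectrum (P *m A *m P) = eigenspectrum A
      & eigenspectrum (P *m A^T *m P) = eigenspectrum A])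
  /\
  (forall P : 'M[R]_n, is_perm_mx P -> bisymmetric_mx P ->
    [/\ eigenspectrum (P *m A *m P *m reverse_mx R n)
          = eigenspectrum (reverse_mx R n *m P *m A *m P),
        eigenspectrum (P *m A^T *m P *m reverse_mx R n)
          = eigenspectrum (reverse_mx R n *m P *m A *m P)
      & eigenspectrum (reverse_mx R n *m P *m A^T *m P)
          = eigenspectrum (reverse_mx R n *m P *m A *m P)]).
Proof.
move=> _; set J := reverse_mx R n.
have trJ : J^T = J := tr_reverse_mx R n.
have JJ : J *m J = 1%:M := reverse_mxK R n.
split=> P permP [symP _]; have trP : P^T = P by rewrite -symP.
  have PP : P *m P = 1%:M by rewrite -{2}trP is_perm_mx_mul_tr.
  split; first exact: eigenspectrum_trmx.
    exact: eigenspectrum_conj.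
  by rewrite (eigenspectrum_conj _ PP) eigenspectrum_trmx.
have PAPJ : eigenspectrum (P *m A *m P *m J) = eigenspectrum (J *m P *m A *m P).
  by rewrite -[RHS](eigenspectrum_conj (J *m P *m A *m P) JJ) !mulmxA JJ mul1mx.
split; first exact: PAPJ.
  rewrite -[RHS](eigenspectrum_trmx (J *m P *m A *m P)).
  by rewrite !trmx_mul trP trJ !mulmxA.
rewrite -PAPJ -[RHS](eigenspectrum_trmx (P *m A *m P *m J)).
by rewrite !trmx_mul trP trJ !mulmxA.
Qed.
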